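(* Let $m$ be a positive integer and let $\mathcal{A}=(a_{i_1i_2\cdots i_m})$ be a real centrosymmetric tensor of order $m$ and dimension $2$. Then $\sum_{i_2,\dots,i_m=1}^{2}a_{1i_2\cdots i_m}$ is an H-eigenvalue of $\mathcal{A}$ with a symmetric H-eigenvector, and $\sum_{i_2,\dots,i_m=1}^{2}a_{1i_2\cdots i_m}(-1)^{i_2+\cdots+i_m+m-1}$ is an H-eigenvalue of $\mathcal{A}$ with a skew symmetric H-eigenvector.
   Context: A real tensor of order $m$ and dimension $n$ is an array $\mathcal{A}=(a_{i_1\cdots i_m})$ of reals with $i_1,\dots,i_m\in[n]=\{1,\dots,n\}$. It is centrosymmetric if $a_{i_1\cdots i_m}=a_{n-i_1+1,\dots,n-i_m+1}$ for all indices. For $x\in\mathbb{R}^n$, $\mathcal{A}x^{m-1}\in\mathbb{R}^n$ has $i$-th component $\sum_{i_2,\dots,i_m=1}^n a_{ii_2\cdots i_m}x_{i_2}\cdots x_{i_m}$, and $x^{[m-1]}=(x_1^{m-1},\dots,x_n^{m-1})$. If $\lambda\in\mathbb{R}$ and $x\in\mathbb{R}^n\setminus\{0\}$ satisfy $\mathcal{A}x^{m-1}=\lambda x^{[m-1]}$, then $\lambda$ is an H-eigenvalue of $\mathcal{A}$ and $x$ a corresponding H-eigenvector. A vector $x\in\mathbb{R}^n$ is symmetric if $x_{n-i+1}=x_i$ for all $i\in[n]$, and skew symmetric if $x_{n-i+1}=-x_i$ for all $i\in[n]$. *)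

(* Defs.v *)
From HB Require Import structures.
From mathcomp Require Import all_boot all_order all_algebra.
From mathcomp Require Import reals.

Set Implicit Arguments.
Unset Strict Implicit.
Unset Printing Implicit Defensive.

Import Order.TTheory GRing.Theory Num.Theory.
Local Open Scope ring_scope.

(* Indices are 0-based: i : 'I_n stands for the index i.+1 of [n], so that
   n - i + 1 becomes rev_ord i. *)

Definition tensor (R : realType) (m n : nat) := {ffun m.-tuple 'I_n -> R}.

Definition centrosymmetric (R : realType) (m n : nat) (A : tensor R m n) :=
  forall t : m.-tuple 'I_n, A t = A [tuple of map (@rev_ord n) t].

(* A x^{m-1} for a tensor A of positive order: the order is written m.+1, so
   the m - 1 trailing indices form an m-tuple. *)
Definition tensor_apply (R : realType) (m n : nat)
    (A : tensor R m.+1 n) (x : 'cV[R]_n) : 'cV[R]_n :=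
  \col_i \sum_(t : m.-tuple 'I_n)
    A [tuple of i :: t] * \prod_(k < m) x (tnth t k) ord0.

Definition vec_pow (R : realType) (n : nat) (x : 'cV[R]_n) (k : nat)
  : 'cV[R]_n := \col_i (x i ord0 ^+ k).

Definition H_eigenpair (R : realType) (m n : nat)
    (A : tensor R m.+1 n) (lambda : R) (x : 'cV[R]_n) :=
  x <> 0 /\ tensor_apply A x = lambda *: vec_pow x m.

Definition symmetric_vec (R : realType) (n : nat) (x : 'cV[R]_n) :=
  forall i : 'I_n, x (rev_ord i) ord0 = x i ord0.

Definition skew_symmetric_vec (R : realType) (n : nat) (x : 'cV[R]_n) :=
  forall i : 'I_n, x (rev_ord i) ord0 = - x i ord0.

(* Main.v *)
(* If x (rev i) = c * x i for all i, reindexing the sum by reversal of all the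
   indices gives (A x^{m-1})_(rev i) = c^(m-1) (A x^{m-1})_i.  In dimension 2
   and for x_1 = 1, the equation at the index 2 thus follows from the equation
   at the index 1, which just says that the eigenvalue is (A x^{m-1})_1.
   Take x = (1, c) with c = 1 or c = -1. *)
Require Import Defs.
From HB Require Import structures.
From mathcomp Require Import all_boot all_order all_algebra.
From mathcomp Require Import reals.

Set Implicit Arguments.
Unset Strict Implicit.
Unset Printing Implicit Defensive.

Import Order.TTheory GRing.Theory Num.Theory.
Local Open Scope ring_scope.

Lemma tensor_apply_rev (R : realType) (m n : nat) (A : tensor R m.+1 n)
    (hA : centrosymmetric A) (c : R) (x : 'cV[R]_n)
    (hx : forall i, x (rev_ord i) ord0 = c * x i ord0) (i : 'I_n) :
  tensor_apply A x (rev_ord i) ord0 = c ^+ m * tensor_apply A x i ord0.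
Proof.
have revK : involutive (fun t : m.-tuple 'I_n => [tuple of map (@rev_ord n) t]).
  by move=> t; apply: val_inj; rewrite /= mapK //; apply: rev_ordK.
rewrite !mxE mulr_sumr (reindex_inj (inv_inj revK)) /=.
apply: eq_bigr => t _.
(* Here the leading index and all [m] trailing ones are reversed at once, so centrosymmetry applies
   to the whole entry; only the [m] factors of the product differ, each by [c]. *)
have -> : A [tuple of rev_ord i :: [tuple of map (@rev_ord n) t]] =
          A [tuple of i :: t].
  by rewrite (hA [tuple of i :: t]); congr (A _); apply: val_inj.
under eq_bigr => k _ do rewrite tnth_map hx.
by rewrite big_split /= prodr_const card_ord mulrCA.
Qed.

Lemma H_eigenpair_dim2 (R : realType) (m : nat) (A : tensor R m.+1 2)
    (hA : centrosymmetric A) (c : R) (x : 'cV[R]_2)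
    (hx : forall i, x (rev_ord i) ord0 = c * x i ord0)
    (x0 : x ord0 ord0 = 1) :
  H_eigenpair A (tensor_apply A x ord0 ord0) x.
Proof.
split=> [xE|].
  by move/eqP: x0; rewrite xE mxE eq_sym oner_eq0.
apply/colP => i; rewrite [RHS]mxE [X in _ * X]mxE.
(* In dimension 2 the reversal swaps the two indices, so [ord0] and its mirror image are all of
   them. *)
have [->|->] : i = ord0 \/ i = rev_ord ord0.
  by case: i => [[|[|//]] lti]; [left|right]; apply: val_inj.
  by rewrite x0 expr1n mulr1.
(* The entry of [x] at the mirror index is [c], so both sides are [c ^+ m] times the eigenvalue. *)
by rewrite (tensor_apply_rev hA hx) hx x0 mulr1 mulrC.
Qed.

(* The order of A is m.+1, i.e. an arbitrary positive integer. *)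
Theorem theorem4p1 (R : realType) (m : nat) (A : tensor R m.+1 2)
    (hA : centrosymmetric A) :
  (exists x : 'cV[R]_2,
     H_eigenpair A (\sum_(t : m.-tuple 'I_2) A [tuple of ord0 :: t]) x
     /\ symmetric_vec x) /\
  (exists x : 'cV[R]_2,
     H_eigenpair A
       (\sum_(t : m.-tuple 'I_2)
          A [tuple of ord0 :: t]
          * (-1) ^+ (\sum_(k < m) (tnth t k).+1 + m)%N) x
     /\ skew_symmetric_vec x).
Proof.
split.
  pose x : 'cV[R]_2 := const_mx 1.
  have hx i : x (rev_ord i) ord0 = 1 * x i ord0 by rewrite !mxE mulr1.
  exists x; split=> [|i]; last by rewrite hx mul1r.
  have -> : \sum_(t : m.-tuple 'I_2) A [tuple of ord0 :: t] =
            tensor_apply A x ord0 ord0.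
    rewrite mxE; apply: eq_bigr => t _.
    by rewrite big1 ?mulr1 // => k _; rewrite mxE.
  by apply: H_eigenpair_dim2 hA _ _ hx _; rewrite mxE.
(* With 0-based indices this is the vector $(1, -1)$, the case $c = -1$. *)
pose x : 'cV[R]_2 := \col_i (-1) ^+ i.
have hx i : x (rev_ord i) ord0 = -1 * x i ord0.
  rewrite !mxE; case: i => [[|[|//]] lti] /=.
    by rewrite expr1 expr0 mulr1.
  by rewrite expr1 expr0 mulrNN mulr1.
exists x; split=> [|i]; last by rewrite hx mulN1r.
set lambda := (X in H_eigenpair A X x).
have -> : lambda = tensor_apply A x ord0 ord0.
  rewrite mxE; apply: eq_bigr => t _; congr (_ * _).
  under [RHS]eq_bigr => k _ do rewrite mxE.
  (* Passing from 1-based to 0-based indices takes [m] out of the sum. With the [m] already in the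
     exponent this makes an even number, so the sign is the product of the entries of [x] at the
     indices in [t]. *)
  have -> : (\sum_(k < m) (tnth t k).+1 = \sum_(k < m) tnth t k + m)%N.
    rewrite -[X in (_ + X)%N]card_ord -sum1_card -big_split /=.
    by apply: eq_bigr => k _; rewrite addn1.
  rewrite -addnA addnn exprD.
  by rewrite -[X in _ * X]signr_odd odd_double mulr1 expr_sum.
by apply: H_eigenpair_dim2 hA _ _ hx _; rewrite mxE.
Qed.
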